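(* The following are equivalent for a commutative semiring $R$ (in particular for a commutative ring $R$): (1) $R$ is a BMax-semiring, i.e. every maximal ideal of $R$ is barely maximal; (2) $J(R)$ is an irredundant intersection of the maximal ideals of $R$ (i.e. in $J(R)=\bigcap_{\mathfrak m\in\mathrm{Max}(R)}\mathfrak m$ no maximal ideal can be omitted); (3) $\mathrm{Max}(R)$ is discrete; (4) $R$ is an FMax-semiring, i.e. $R$ has only finitely many maximal ideals.
   Context: A semiring is a set $R$ with operations $+,\cdot$ such that $(R,+,0)$ is a commutative monoid, $(R,\cdot,1)$ is a monoid, multiplication distributes over addition from both sides, $0r=0=r0$ for all $r\in R$, and $1\ne 0$; it is commutative if $\cdot$ is. Every ring (with $1\neq 0$) is a semiring. An ideal of a commutative semiring is an additive submonoid closed under multiplication by $R$; prime and maximal ideals are (proper and) defined as for rings. $\mathrm{Max}(R)$ is the set of maximal ideals, $\mathrm{Spec}(R)$ the set of prime ideals with the Zariski topology (closed sets $V(I)=\{P: I\subseteq P\}$ for ideals $I$). Maximal ideals of $R$ are prime, and $\mathrm{Max}(R)$ carries the subspace topology. $J(R)$ is the intersection of all maximal ideals. A maximal ideal $\mathfrak m$ is barely maximal iff the intersection of all the other maximal ideals is not contained in $\mathfrak m$ (the empty intersection being $R$). *)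

(* Defs.v *)
From HB Require Import structures.
From mathcomp Require Import all_boot all_order all_algebra.
From mathcomp Require Import all_classical topology.

Set Implicit Arguments.
Unset Strict Implicit.
Unset Printing Implicit Defensive.

Import GRing.Theory.
Local Open Scope classical_set_scope.
Local Open Scope ring_scope.

(* Ideals of a semiring are not assumed decidable, so they are classical sets;
   the ideals of ring_quotient are boolean predicates over rings only. *)
Section Ideals.
Context {R : comNzSemiRingType}.

Definition ideal (I : set R) : Prop :=
  [/\ I 0, (forall x y, I x -> I y -> I (x + y)) &
      (forall a x, I x -> I (a * x))].

Definition prime_ideal (P : set R) : Prop :=
  [/\ ideal P, P <> setT & forall x y, P (x * y) -> P x \/ P y].

Definition maximal_ideal (M : set R) : Prop :=
  [/\ ideal M, M <> setT &
      forall I, ideal I -> I <> setT -> M `<=` I -> I = M].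

Lemma ideal_proper1 (I : set R) : ideal I -> I <> setT -> ~ I 1.
Proof.
move=> [_ _ IM] In1 I1; apply: In1; apply/seteqP; split=> // x _.
by rewrite -[x]mulr1; exact: IM.
Qed.

Lemma maximal_ideal_prime (M : set R) : maximal_ideal M -> prime_ideal M.
Proof.
move=> [idM Mproper Mmax]; split=> // x y Mxy.
have [M0 MD MM] := idM.
have [Mx|nMx] := pselect (M x); [by left | right].
pose I : set R := [set z | exists m r, M m /\ z = m + r * x].
have idI : ideal I.
  split.
  - by exists 0, 0; rewrite mul0r addr0.
  - move=> _ _ [m [r [Mm ->]]] [n [s [Mn ->]]].
    by exists (m + n), (r + s); split; [exact: MD | rewrite mulrDl addrACA].
  - move=> a _ [m [r [Mm ->]]].
    by exists (a * m), (a * r); split; [exact: MM | rewrite mulrDr mulrA].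
have [IT|/(Mmax _ idI) IM] := pselect (I = setT).
  have [m [r [Mm e1]]] : I 1 by rewrite IT.
  rewrite -[y]mul1r e1 mulrDl; apply: MD; first by rewrite mulrC; exact: MM.
  by rewrite -mulrA; exact: MM.
exfalso; apply: nMx; rewrite -IM; last first.
  by move=> m Mm; exists m, 0; rewrite mul0r addr0.
by exists 0, 1; rewrite mul1r add0r.
Qed.

End Ideals.

Definition Max (R : comNzSemiRingType) : set (set R) := maximal_ideal.
Arguments Max : clear implicits.

Definition jacobson (R : comNzSemiRingType) : set R :=
  \bigcap_(M in Max R) M.
Arguments jacobson : clear implicits.

Record Spec (R : comNzSemiRingType) : Type := MkSpec {
  ideal_of : set R;
  ideal_ofP : prime_ideal ideal_of }.

Section Zariski.
Context {R : comNzSemiRingType}.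

HB.instance Definition _ := gen_eqMixin (Spec R).
HB.instance Definition _ := gen_choiceMixin (Spec R).

Definition zeros (I : set R) : set (Spec R) := [set P | I `<=` ideal_of P].

Definition zariski_open : set (set (Spec R)) :=
  [set U | exists2 I, ideal I & U = ~` zeros I].

Lemma zariski_openT : zariski_open setT.
Proof.
exists setT; first by split.
apply/esym/seteqP; split=> // P _ TP.
by have [_ Pn _] := ideal_ofP P; apply: Pn; apply/seteqP; split.
Qed.

Lemma zariski_openI : setI_closed zariski_open.
Proof.
move=> _ _ [I [I0 ID IM] ->] [J [J0 JD JM] ->].
exists (I `&` J).
  split; first by split.
  - by move=> x y [? ?] [? ?]; split; [exact: ID | exact: JD].
  - by move=> a x [? ?]; split; [exact: IM | exact: JM].
rewrite -setCU; congr (~` _); apply/seteqP; split=> P /=.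
  by case=> sub x [Ix Jx]; exact: sub.
move=> IJP; apply: contrapT => /not_orP[/existsNP[x /not_implyP[Ix nPx]]].
move=> /existsNP[y /not_implyP[Jy nPy]].
have [_ _ /(_ x y) []] // := ideal_ofP P.
by apply: IJP; split; [rewrite mulrC; exact: IM | exact: JM].
Qed.

Lemma zariski_open_bigU (I : Type) (f : I -> set (Spec R)) :
  (forall i, zariski_open (f i)) -> zariski_open (\bigcup_i f i).
Proof.
move=> /(_ _)/cid2 fo.
pose G := \bigcap_(J in [set J | ideal J /\ forall i, s2val (fo i) `<=` J]) J.
exists G.
  split.
  - by move=> J [[]].
  - by move=> x y Gx Gy J JP; have [[_ JD _] _] := JP; exact: JD (Gx _ JP) (Gy _ JP).
  - by move=> a x Gx J JP; have [[_ _ JM] _] := JP; exact: JM (Gx _ JP).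
apply/seteqP; split=> P /=.
  move=> [i _]; rewrite {1}(s2valP' (fo i)) /= => nP GP.
  by apply: nP => x Ix; apply: GP => J [_ sub]; exact: sub Ix.
move=> nGP; apply: contrapT => nfP; apply: nGP => x; apply.
split; first by have [] := ideal_ofP P.
move=> i y Iy; apply: contrapT => nPy; apply: nfP; exists i => //.
by rewrite (s2valP' (fo i)) /=; move=> /(_ y Iy).
Qed.

HB.instance Definition _ := isOpenTopological.Build (Spec R)
  zariski_openT zariski_openI zariski_open_bigU.

End Zariski.

(* Max(R) as a subset of Spec(R), by maximal_ideal_prime; coerced to a type, it
   carries the subspace topology of topology_theory.subtype_topology. *)
Definition MaxSpec (R : comNzSemiRingType) : set (Spec R) :=
  [set P | Max R (ideal_of P)].
Arguments MaxSpec : clear implicits.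

Lemma image_MaxSpec (R : comNzSemiRingType) :
  @ideal_of R @` MaxSpec R = Max R.
Proof.
apply/seteqP; split=> [_ [P MP <-] //|M MM].
by exists (MkSpec (maximal_ideal_prime MM)).
Qed.

Definition discrete_space (T : topologicalType) : Prop :=
  forall A : set T, open A.

Definition barely_maximal (R : comNzSemiRingType) (M : set R) : Prop :=
  Max R M /\ ~ (\bigcap_(N in Max R `\ M) N `<=` M).

Definition BMax_semiring (R : comNzSemiRingType) : Prop :=
  forall M : set R, Max R M -> barely_maximal M.

Definition FMax_semiring (R : comNzSemiRingType) : Prop :=
  finite_set (Max R).

Definition jacobson_irredundant (R : comNzSemiRingType) : Prop :=
  forall M : set R, Max R M -> \bigcap_(N in Max R `\ M) N <> jacobson R.

(* Main.v *)
Require Import Defs.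
From mathcomp Require Import all_boot all_order all_algebra.
From mathcomp Require Import all_classical topology.

(* The substantial implication is from barely maximal ideals to finiteness.
   The elements lying in all but finitely many maximal ideals form an ideal K.
   If every maximal ideal M is barely maximal, then K contains an element that
   avoids M but lies in all other maximal ideals, so K is in no maximal ideal;
   hence 1 is in K, and there are only finitely many maximal ideals. Openness
   of the singleton {M} in Max(R) is another way to say that M is barely
   maximal, and for finitely many maximal ideals barely maximality follows from
   prime avoidance of a product. *)

Import GRing.Theory.
Local Open Scope classical_set_scope.
Local Open Scope ring_scope.

Section Ideals.
Context {R : comNzSemiRingType}.
Implicit Types I J M N : set R.

Lemma ideal_bigcap (F : set (set R)) :
  F `<=` ideal -> ideal (\bigcap_(I in F) I).
Proof.
move=> Fid; split=> [I /Fid[]//|x y Fx Fy I FI|a x Fx I FI].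
- by have [_ + _] := Fid I FI; apply; [exact: Fx | exact: Fy].
- by have [_ _] := Fid I FI; apply; exact: Fx.
Qed.

Lemma maximal_ideal_incl M N :
  maximal_ideal M -> maximal_ideal N -> M `<=` N -> M = N.
Proof. by move=> [_ _ Mmax] [idN Nn _] /(Mmax _ idN Nn). Qed.

Lemma exists_maximal_ideal I :
  ideal I -> ~ I 1 -> exists2 M, maximal_ideal M & I `<=` M.
Proof.
move=> [I0 ID IM] nI1.
(* Absorbing I is, for nonempty sets, the same as containing it, but it also
   holds for the union of the empty chain. *)
pose P (A : set R) := [/\ forall x y, A x -> A y -> A (x + y),
  forall a x, A x -> A (a * x), ~ A 1 & forall x y, A x -> I y -> A y].
have [|A [[AD AM nA1 AI] Amax]] := @Zorn_bigcup R P.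
  move=> F FP Ftot; split.
  - move=> x y [X FX Xx] [Y FY Yy].
    have [XY|YX] := Ftot _ _ FX FY.
      by have [YD _ _ _] := FP _ FY; exists Y => //; exact: YD (XY _ Xx) Yy.
    by have [XD _ _ _] := FP _ FX; exists X => //; exact: XD Xx (YX _ Yy).
  - by move=> a x [X FX Xx]; have [_ XM _ _] := FP _ FX; exists X => //;
    exact: XM.
  - by move=> [X FX X1]; have [_ _ + _] := FP _ FX.
  - by move=> x y [X FX Xx] Iy; have [_ _ _ XI] := FP _ FX; exists X => //;
    exact: XI Xx Iy.
(* The empty set satisfies [P] vacuously, so it must be excluded: were [A] empty, [I] would be a
   strictly larger set satisfying [P], as it contains 0. *)
have [x Ax] : A !=set0.
  apply: contrapT => /set0P/negP/negPn/eqP A0; apply: (Amax I).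
    by rewrite A0; split=> // /(_ 0 I0).
  by split.
have IA : I `<=` A by move=> y; exact: AI Ax.
exists A => //; split; first by split => //; exact: IA.
  by move=> AT; apply: nA1; rewrite AT.
move=> J idJ Jn AJ; apply: contrapT => JA; apply: (Amax J).
  by rewrite properEneq; split=> //; apply/eqP => AJe; apply: JA.
have nJ1 := ideal_proper1 idJ Jn; have [_ JD JM] := idJ.
by split=> // ? y _ /IA/AJ.
Qed.

Lemma prime_ideal_prod (T : eqType) (P : set R) (s : seq T) (f : T -> R) :
  prime_ideal P -> (forall i, i \in s -> ~ P (f i)) ->
  ~ P (\prod_(i <- s) f i).
Proof.
move=> [idP Pn Pprime]; elim: s => [_|i s IHs nPf].
  by rewrite big_nil; exact: ideal_proper1.
rewrite big_cons => /Pprime[]; first by apply: nPf; rewrite mem_head.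
by apply: IHs => j js; apply: nPf; rewrite in_cons js orbT.
Qed.

Lemma ideal_prod (T : eqType) I (s : seq T) (f : T -> R) i :
  ideal I -> i \in s -> I (f i) -> I (\prod_(j <- s) f j).
Proof.
move=> [_ _ IM] si Ifi; rewrite (perm_big _ (perm_to_rem si)) big_cons /= mulrC.
exact: IM.
Qed.

Lemma Spec_inj : injective (@ideal_of R).
Proof.
move=> [I pI] [J pJ] /= IJ; case: _ / IJ pJ => pJ.
by rewrite (Prop_irrelevance pI pJ).
Qed.

Lemma open_zeros I : ideal I -> open (~` zeros I).
Proof. by exists I. Qed.

End Ideals.

Section Equivalences.
Context {R : comNzSemiRingType}.

Lemma BMax_irredundant : BMax_semiring R -> jacobson_irredundant R.
Proof.
move=> bmax M MM eqJ; have [_] := bmax M MM; apply; rewrite eqJ => x; exact.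
Qed.

(** If the other maximal ideals already intersect inside [M], omitting [M] leaves the Jacobson
    radical unchanged. *)
Lemma irredundant_BMax : jacobson_irredundant R -> BMax_semiring R.
Proof.
move=> irr M MM; split=> // sub; apply: (irr M MM).
apply/seteqP; split=> x Jx N NM; last by case: NM => NM _; exact: Jx.
by have [->|nNM] := pselect (N = M); [exact: sub | apply: Jx; split].
Qed.

Lemma BMax_discrete : BMax_semiring R -> discrete_space (MaxSpec R).
Proof.
move=> bmax A.
pose others (p : MaxSpec R) : set R :=
  \bigcap_(N in Max R `\ ideal_of (\val p)) N.
(* Each set of this union meets [MaxSpec R] in [p] alone: any other maximal ideal contains
   [others p], while [p] does not, being barely maximal. *)
exists (\bigcup_(p in A) ~` zeros (others p)).
  apply: bigcup_open => p _; apply: open_zeros.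
  by apply: ideal_bigcap => N [[]].
apply/seteqP; split=> q /=.
  move=> [p Ap nz]; suff -> : q = p by [].
  apply/val_inj/Spec_inj; apply: contrapT => neq.
  apply: nz => x; apply; split => //.
  exact: set_valP q.
move=> Aq; exists q => //.
by have [_] := bmax _ (set_valP q); apply: contra_not.
Qed.

Lemma discrete_BMax : discrete_space (MaxSpec R) -> BMax_semiring R.
Proof.
move=> disc M MM; split=> // sub.
pose toMax N (NM : Max R N) : MaxSpec R :=
  exist _ (MkSpec (maximal_ideal_prime NM)) (mem_set (NM : MaxSpec R (MkSpec _))).
(* Openness of the singleton yields an ideal [I] contained in every maximal ideal except [M]; then
   [sub] forces [I] into [M] as well, a contradiction. *)
have [_ [I idI ->] eqI] := disc [set toMax M MM].
have : [set toMax M MM] (toMax M MM) by [].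
rewrite -eqI; apply => x Ix; apply: sub => N [NM nNM].
suff: zeros I (\val (toMax N NM)) by apply.
apply: contrapT => nz.
have /(congr1 (@ideal_of R \o \val)) : [set toMax M MM] (toMax N NM) by rewrite -eqI.
exact: nNM.
Qed.

Lemma BMax_FMax : BMax_semiring R -> FMax_semiring R.
Proof.
move=> bmax; pose K := [set x | finite_set [set M | Max R M /\ ~ M x]].
have idK : ideal K.
  split.
  - by apply: sub_finite_set (finite_set0 _) => M [[[M0 _ _]]].
  - move=> x y Kx Ky; have : finite_set ([set M | Max R M /\ ~ M x] `|`
        [set M | Max R M /\ ~ M y]) by rewrite finite_setU.
    apply: sub_finite_set => M [MM nM]; have [[_ MD _] _ _] := MM.
    have [Mx|] := pselect (M x); last by left.
    by right; split => // My; apply: nM; exact: MD.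
  - move=> a x; apply: sub_finite_set => M [MM nM]; split=> // Mx.
    by apply: nM; have [[_ _ MI] _ _] := MM; exact: MI.
have [K1|/(exists_maximal_ideal _ idK)[M MM KM]] := pselect (K 1).
  apply: sub_finite_set K1 => M MM; split=> //.
  by have [idM Mn _] := MM; exact: ideal_proper1.
have [_ []] := bmax M MM => x othersx; apply: KM.
apply: sub_finite_set (finite_set1 M) => N [NM nNx].
by apply: contrapT => nNM; apply: nNx; exact: othersx.
Qed.

Lemma FMax_BMax : FMax_semiring R -> BMax_semiring R.
Proof.
move=> /finite_seqP[s sE] M MM; split=> // sub.
(* Distinct maximal ideals are incomparable, which provides [x]; 0 is a dummy value where nothing is
   required. *)
have /choice[f fP] N : exists x, Max R N -> N <> M -> N x /\ ~ M x.
  have [[NM nNM]|nP] := pselect (Max R N /\ N <> M); last first.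
    by exists 0 => NM nNM; case: nP.
  have /existsNP[x /not_implyP[Nx nMx]] : ~ (N `<=` M).
    by move=> NsubM; apply: nNM; exact: maximal_ideal_incl.
  by exists x.
have memt N : (N \in [seq N <- s | N != M]) <-> (Max R `\ M) N.
  rewrite mem_filter; split=> [/andP[/eqP NM Ns]|[NM /eqP ->]].
    by split=> //; rewrite sE.
  by rewrite sE in NM.
(* The product of the [f N] lies in every other maximal ideal, hence in [M] by [sub], although [M]
   is prime and contains no factor. If [M] is the only maximal ideal, the product is 1. *)
apply: (@prime_ideal_prod _ _ M [seq N <- s | N != M] f).
- exact: maximal_ideal_prime.
- by move=> N /memt[NM nNM]; have [] := fP N NM nNM.
- apply: sub => N NP; have [NM nNM] := NP; apply: (@ideal_prod _ _ N _ f N).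
  + by have [] := NM.
  + exact/memt.
  + by have [] := fP N NM nNM.
Qed.

End Equivalences.

Theorem corollary2p24 (R : comNzSemiRingType) :
  [<-> BMax_semiring R;
       jacobson_irredundant R;
       discrete_space (MaxSpec R);
       FMax_semiring R].
Proof.
tfae.
- exact: BMax_irredundant.
- by move=> /irredundant_BMax/BMax_discrete.
- by move=> /discrete_BMax/BMax_FMax.
- exact: FMax_BMax.
Qed.
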